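(* Let $p\ge2$ be an integer. Then the set of all $p$-adic permutations forms a subgroup of the group of all permutations of $\mathbb{Z}_p$ with respect to composition.
   Context: $p\ge2$ is an integer, not necessarily prime, and $\mathbb{Z}_p=\varprojlim \mathbb{Z}/p^k\mathbb{Z}$. A $p$-adic permutation is a permutation $\pi$ of $\mathbb{Z}_p$ such that $\pi(n)\equiv n\pmod p$ for all $n\in\mathbb{Z}_p$, and for all integers $k\ge1$ and all $m,n\in\mathbb{Z}_p$: $m\equiv n\pmod{p^k}\Leftrightarrow\pi(m)\equiv\pi(n)\pmod{p^k}$. *)

(* Defs.v *)
From HB Require Import structures.
From mathcomp Require Import all_boot all_algebra.
From mathcomp Require Import all_classical.

Set Implicit Arguments.
Unset Strict Implicit.
Unset Printing Implicit Defensive.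

Import GRing.Theory.

Section Padic.

Local Open Scope ring_scope.

Variable p : nat.

(* Reduction Z/p^(k+2) -> Z/p^(k+1). *)
Definition padic_red (k : nat) (a : 'Z_(p ^ k.+2)) : 'Z_(p ^ k.+1) := a%:R.

(* The projective limit of the rings Z/p^k, k >= 1; [padic_coord x k] is the
   component of x in Z/p^(k+1).  Level p^0 is left out because 'Z_1 is the
   ring Z/2; the type is only meaningful for p >= 2. *)
Record padic := Padic {
  padic_coord :> forall k : nat, 'Z_(p ^ k.+1);
  padic_coherent : forall k : nat, padic_red (padic_coord k.+1) = padic_coord k
}.

Lemma padic_ext (x y : padic) : (forall k, x k = y k) -> x = y.
Proof.
case: x y => [x xP] [y yP] /= xy.
have {}xy : x = y by apply/functional_extensionality_dep.
by subst y; congr Padic; apply: Prop_irrelevance.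
Qed.

HB.instance Definition _ := gen_eqMixin padic.
HB.instance Definition _ := gen_choiceMixin padic.

Lemma dvdn_Zp_trunc k :
  ((Zp_trunc (p ^ k.+1)).+2 %| (Zp_trunc (p ^ k.+2)).+2)%N.
Proof.
case: p => [|[|q]]; [by rewrite !exp0n | by rewrite !exp1n |].
by rewrite !Zp_cast ?dvdn_exp2l // -[1%N](expn0 q.+2) ltn_exp2l.
Qed.

Lemma natrZ_mod k n :
  ((n %% (Zp_trunc (p ^ k.+2)).+2)%N)%:R = n%:R :> 'Z_(p ^ k.+1).
Proof.
by apply/val_inj; rewrite !Zp_nat /= modn_dvdm // dvdn_Zp_trunc.
Qed.

Fact padic0_coherent k : padic_red (0 : 'Z_(p ^ k.+2)) = 0.
Proof. by []. Qed.

Fact padic1_coherent k : padic_red (1 : 'Z_(p ^ k.+2)) = 1.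
Proof. by rewrite /padic_red /= natrZ_mod. Qed.

Lemma padic_redD k : {morph @padic_red k : a b / a + b}.
Proof. by move=> a b; rewrite /padic_red /= natrZ_mod natrD. Qed.

Lemma padic_redM k : {morph @padic_red k : a b / a * b}.
Proof. by move=> a b; rewrite /padic_red /= natrZ_mod natrM. Qed.

Fact padicD_coherent (x y : padic) k :
  padic_red (x k.+1 + y k.+1) = x k + y k.
Proof. by rewrite padic_redD !padic_coherent. Qed.

Fact padicM_coherent (x y : padic) k :
  padic_red (x k.+1 * y k.+1) = x k * y k.
Proof. by rewrite padic_redM !padic_coherent. Qed.

Fact padicN_coherent (x : padic) k : padic_red (- x k.+1) = - x k.
Proof.
by apply/eqP; rewrite -addr_eq0 -(padic_coherent x k) -padic_redD addNr.
Qed.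

Definition padic0 := Padic padic0_coherent.
Definition padic1 := Padic padic1_coherent.
Definition padicD x y := Padic (padicD_coherent x y).
Definition padicN x := Padic (padicN_coherent x).
Definition padicM x y := Padic (padicM_coherent x y).

Fact padicDA : associative padicD.
Proof. by move=> x y z; apply: padic_ext => k /=; rewrite addrA. Qed.

Fact padicDC : commutative padicD.
Proof. by move=> x y; apply: padic_ext => k /=; rewrite addrC. Qed.

Fact padicD0 : left_id padic0 padicD.
Proof. by move=> x; apply: padic_ext => k /=; rewrite add0r. Qed.

Fact padicDN : left_inverse padic0 padicN padicD.
Proof. by move=> x; apply: padic_ext => k /=; rewrite addNr. Qed.

HB.instance Definition _ :=
  GRing.isZmodule.Build padic padicDA padicDC padicD0 padicDN.

Fact padicMA : associative padicM.
Proof. by move=> x y z; apply: padic_ext => k /=; rewrite mulrA. Qed.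

Fact padicMC : commutative padicM.
Proof. by move=> x y; apply: padic_ext => k /=; rewrite mulrC. Qed.

Fact padicM1 : left_id padic1 padicM.
Proof. by move=> x; apply: padic_ext => k /=; rewrite mul1r. Qed.

Fact padicMD : left_distributive padicM +%R.
Proof. by move=> x y z; apply: padic_ext => k /=; rewrite mulrDl. Qed.

Fact padic1_neq0 : padic1 != 0.
Proof.
by apply/eqP => /(congr1 (fun x : padic => val (x 0))).
Qed.

HB.instance Definition _ := GRing.Zmodule_isComNzRing.Build padic
  padicMA padicMC padicM1 padicMD padic1_neq0.

End Padic.

Definition congr_mod (R : comPzRingType) (d x y : R) : Prop :=
  exists z : R, (x - y = d * z)%R.

Section Permutations.

Variable T : Type.

(* {perm T} is only available for a finite T. *)
Record permutation := Permutation {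
  permutation_fun :> T -> T;
  permutation_bij : bijective permutation_fun
}.

Lemma permutation_ext (s t : permutation) : (forall x, s x = t x) -> s = t.
Proof.
case: s t => [s sP] [t tP] /= /funext st.
by subst t; congr Permutation; apply: Prop_irrelevance.
Qed.

HB.instance Definition _ := gen_eqMixin permutation.
HB.instance Definition _ := gen_choiceMixin permutation.

Lemma permutation_inv_ex (s : permutation) :
  exists g : T -> T, cancel s g /\ cancel g s.
Proof. by case: (permutation_bij s) => g; exists g. Qed.

Definition permutation_inv_fun (s : permutation) : T -> T :=
  sval (cid (permutation_inv_ex s)).

Lemma permutation_funK (s : permutation) : cancel s (permutation_inv_fun s).
Proof. by rewrite /permutation_inv_fun; case: cid => g []. Qed.

Lemma permutation_inv_funK (s : permutation) :
  cancel (permutation_inv_fun s) s.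
Proof. by rewrite /permutation_inv_fun; case: cid => g []. Qed.

Fact id_bijective : bijective (@id T).
Proof. by exists id. Qed.

Definition permutation_one := Permutation id_bijective.

Definition permutation_mul (s t : permutation) :=
  Permutation (bij_comp (permutation_bij s) (permutation_bij t)).

Definition permutation_inv (s : permutation) :=
  Permutation (Bijective (permutation_inv_funK s) (permutation_funK s)).

Fact permutation_mulA : associative permutation_mul.
Proof. by move=> s t u; apply: permutation_ext. Qed.

Fact permutation_mul1 : left_id permutation_one permutation_mul.
Proof. by move=> s; apply: permutation_ext. Qed.

Fact permutation_1mul : right_id permutation_one permutation_mul.
Proof. by move=> s; apply: permutation_ext. Qed.

Fact permutation_mulV :
  left_inverse permutation_one permutation_inv permutation_mul.
Proof. by move=> s; apply: permutation_ext => x; apply: permutation_funK. Qed.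

Fact permutation_Vmul :
  right_inverse permutation_one permutation_inv permutation_mul.
Proof.
by move=> s; apply: permutation_ext => x; apply: permutation_inv_funK.
Qed.

HB.instance Definition _ := isGroup.Build permutation permutation_mulA
  permutation_mul1 permutation_1mul permutation_mulV permutation_Vmul.

End Permutations.

Definition padic_permutation (p : nat) (s : permutation (padic p)) : Prop :=
  (forall n : padic p, congr_mod (p%:R)%R (s n) n) /\
  (forall (k : nat) (m n : padic p), 1 <= k ->
     congr_mod (p%:R ^+ k)%R m n <-> congr_mod (p%:R ^+ k)%R (s m) (s n)).

Definition padic_permutations (p : nat) : set (permutation (padic p)) :=
  [set s | padic_permutation s]%classic.

Arguments padic_permutations p : clear implicits.

(* Main.v *)
Require Import Defs.
From mathcomp Require Import all_boot all_algebra.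
From mathcomp Require Import all_classical.

Import GRing.Theory.

(** Congruence modulo a fixed element is an equivalence relation, so being congruent to the identity
    mod [p] passes to composites and inverses. The condition at [p ^ k] is an equivalence: it chains
    along composites and, read backwards, holds for inverses ([padic_permutation_mul],
    [padic_permutation_inv]). *)

Lemma congr_mod_refl (R : comPzRingType) (d x : R) : congr_mod d x x.
Proof. by exists 0%R; rewrite subrr mulr0. Qed.

Lemma congr_mod_sym (R : comPzRingType) (d x y : R) :
  congr_mod d x y -> congr_mod d y x.
Proof. by case=> z xy; exists (- z)%R; rewrite -opprB xy mulrN. Qed.

Lemma congr_mod_trans (R : comPzRingType) (d x y z : R) :
  congr_mod d x y -> congr_mod d y z -> congr_mod d x z.
Proof.
by case=> u xy [v yz]; exists (u + v)%R; rewrite mulrDr -xy -yz addrA subrK.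
Qed.

Lemma padic_permutation_one (p : nat) :
  padic_permutation (permutation_one (padic p)).
Proof. by split=> [n|//]; apply: congr_mod_refl. Qed.

Lemma padic_permutation_mul (p : nat) (s t : permutation (padic p)) :
  padic_permutation s -> padic_permutation t ->
  padic_permutation (permutation_mul s t).
Proof.
move=> [s1 sk] [t1 tk]; split=> [n|k m n k1] /=.
  (* The chain is [s (t n)], [t n], [n]. *)
  exact: congr_mod_trans (s1 _) (t1 _).
by rewrite (tk k m n k1) (sk k _ _ k1).
Qed.

Lemma padic_permutation_inv (p : nat) (s : permutation (padic p)) :
  padic_permutation s -> padic_permutation (permutation_inv s).
Proof.
move=> [s1 sk]; split=> [n|k m n k1] /=.
  (* Apply the condition on [s] at the preimage of [n]. *)
  by apply: congr_mod_sym; rewrite -{1}(permutation_inv_funK s n); apply: s1.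
(* The equivalence for [s], taken at the preimages of [m] and [n], is the one wanted with its sides
   swapped. *)
by apply: iff_sym; rewrite (sk k _ _ k1) !permutation_inv_funK.
Qed.

Theorem theorem3p19 (p : nat) (hp : 2 <= p) :
  group_closed (mem (padic_permutations p)).
Proof.
have memE s : s \in mem (padic_permutations p) <-> padic_permutation s.
  by split; [move/set_mem | move=> ?; apply/mem_set].
(* [group_closed] asks for the unit and for quotients of two members. *)
split=> [|s t /memE sP /memE tP]; apply/memE.
  exact: padic_permutation_one.
by apply: padic_permutation_mul => //; apply: padic_permutation_inv.
Qed.
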